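(* Let $q\in\mathbb{C}^\times$, let $\lambda=(\lambda_1,\dots,\lambda_z)$ be a composition, let $k\ge0$ be an integer, $x\in N\Lambda^q$, and let $1\le m\le z$. Then $$(h_\lambda,e_kx)=\sum_{l=0}^m\ \sum_{\sigma_l^m\in O_l^m}q^{|(\lambda_m^L-\sigma_l^m)(T_k^m-r(\sigma_l^m))|}\,(h_{\lambda_m^G},e_{k-l}x)_{h_{\lambda_m^L-\sigma_l^m}}.$$
   Context: $N\Lambda^q$ is the free associative $\mathbb{Z}$-graded $\mathbb{C}$-algebra on generators $h_m$ ($m\ge1$, $\deg h_m=m$), with $h_0=1$, $h_m=0$ for $m<0$; $h_\alpha=h_{\alpha_1}\cdots h_{\alpha_z}$ for a sequence $\alpha$ (zero entries contribute $h_0=1$, and $h_\alpha=1$ for the empty sequence). $N\Lambda^q\otimes N\Lambda^q$ has multiplication $(w\otimes x)(y\otimes z)=q^{\deg(x)\deg(y)}(wy\otimes xz)$, and $\Delta$ is the algebra homomorphism with $\Delta(h_m)=\sum_{j=0}^m h_j\otimes h_{m-j}$. The bilinear form is $(h_\lambda,h_\mu)=\sum_{C\in S_\lambda\backslash S_N/S_\mu}q^{\ell(w_C)}$ for compositions $\lambda,\mu$ of $N$ ($S_\lambda,S_\mu$ Young subgroups, $w_C$ the minimal length representative of $C$), and $0$ if $|\lambda|\ne|\mu|$. It satisfies $(y_1y_2,x)=(y_1\otimes y_2,\Delta(x))$ with $(w\otimes x,y\otimes z)=(w,y)(x,z)$. The elements $e_k$ are defined by $e_k=0$ for $k<0$,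 $e_0=1$ and $\sum_{i=0}^k(-1)^iq^{\binom i2}e_ih_{k-i}=0$ for $k\ge1$. Insertion: $(h_\lambda,e_kx)$ is computed by expanding it as a linear combination of terms $(h_\alpha,x)$, by recording how the strands of $h_\lambda$ are split between $e_k$ and $x$; $(h_\lambda,e_kx)_{h_\mu}$ denotes the result of the same computation with $h_\mu$ put at the beginning of $h_\alpha$ in every term $(h_\alpha,x)$. Explicitly, writing $\Delta(h_\lambda)=\sum a\otimes b$, $$(h_\lambda,e_kx)=\sum(a,e_k)(b,x),\qquad (h_\lambda,e_kx)_{h_\mu}=\sum(a,e_k)(h_\mu b,x).$$ Notation for sequences: $O_l^m$ is the set of binary sequences $\sigma_l^m$ of length $m$ with exactly $l$ entries equal to $1$. $\lambda_m^L=(\lambda_1,\dots,\lambda_m)$ and $\lambda_m^G=(\lambda_{m+1},\dots,\lambda_z)$. $T_k^m=(k,k,\dots,k)$ has $m$ entries. $r(\lambda)=(\lambda_1,\lambda_1+\lambda_2,\dots,\lambda_1+\dots+\lambda_z)$ is the sequence of partial sums. Subtraction and multiplication of sequences of equal length are componentwise, and $|\lambda|=\lambda_1+\dots+\lambda_z$ is the sum of the entries. *)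

(* Defs.v *)
From HB Require Import structures.
From mathcomp Require Import all_boot all_order all_algebra all_fingroup.
From mathcomp Require Import finmap monalg.

Set Implicit Arguments.
Unset Strict Implicit.
Unset Printing Implicit Defensive.

Import GRing.Theory.
Local Open Scope ring_scope.
Local Open Scope fset_scope.

(* Words in the generators: the letter n : nat stands for h_{n+1}, so that the
   letters are exactly the h_m with m >= 1. *)
Notation word := {fmonom nat}.
Notation NL F := {malg F[word]}.
(* NL \otimes NL is the free module on pairs of words. *)
Notation NL2 F := {malg F[(word * word)%type]}.

Definition parts (w : word) : seq nat := [seq n.+1 | n <- w].
Definition wdeg (w : word) : nat := sumn (parts w).

Section Algebra.
Variable F : fieldType.
Implicit Types (q : F) (x y : NL F) (s t : NL2 F).

Definition h (m : int) : NL F :=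
  match m with
  | Posz 0 => 1
  | Posz n.+1 => << fmu n >>
  | Negz _ => 0
  end.

Definition hs (alpha : seq int) : NL F := \prod_(a <- alpha) h a.

Definition tens x y : NL2 F :=
  \sum_(u <- msupp x) \sum_(v <- msupp y) << x@_u * y@_v *g (u, v) >>.

Definition tmul q s t : NL2 F :=
  \sum_(u <- msupp s) \sum_(v <- msupp t)
    << q ^+ (wdeg u.2 * wdeg v.1) * (s@_u * t@_v)
       *g (mmul u.1 v.1, mmul u.2 v.2) >>.

Definition Delta_gen (m : nat) : NL2 F :=
  \sum_(j < m.+1) tens (h j) (h (m - j)%N).

Definition Delta q x : NL2 F :=
  \sum_(w <- msupp x)
    x@_w *: foldr (fun m t => tmul q (Delta_gen m) t) (tens 1 1) (parts w).

End Algebra.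

(* [reshape_index alpha i] is the index of the part of alpha that contains the
   position i < |alpha|. *)
Definition Young (N : nat) (alpha : seq nat) : {set 'S_N} :=
  [set s : 'S_N |
    [forall i, reshape_index alpha (s i) == reshape_index alpha i]].

Lemma Young_group_set N alpha : group_set (Young N alpha).
Proof.
apply/group_setP; split=> [|s t].
  by rewrite inE; apply/forallP => i; rewrite perm1.
rewrite !inE => /forallP sY /forallP tY; apply/forallP => i.
by rewrite permM (eqP (tY _)) sY.
Qed.
Canonical Young_group N alpha := Group (Young_group_set N alpha).

Definition perm_length (N : nat) (w : 'S_N) : nat :=
  #|[set p : 'I_N * 'I_N | (p.1 < p.2)%N && (w p.2 < w p.1)%N]|.

Definition double_cosets (N : nat) (A B : {set 'S_N}) : {set {set 'S_N}} :=
  [set (A :* w * B)%g | w : 'S_N].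

(* The minimiser is unique when C is a double coset of Young subgroups; only
   its length is used below. *)
Definition min_rep (N : nat) (C : {set 'S_N}) : 'S_N :=
  [arg min_(w < repr C in C) perm_length w].

Section Pairing.
Variable F : fieldType.
Implicit Types (q : F) (x y : NL F).

Definition pairing_comp q (alpha beta : seq nat) : F :=
  let N := sumn alpha in
  if sumn beta == N then
    \sum_(C in double_cosets (Young N alpha) (Young N beta))
      q ^+ perm_length (min_rep C)
  else 0.

Definition pairing q x y : F :=
  \sum_(u <- msupp x) \sum_(v <- msupp y)
    x@_u * y@_v * pairing_comp q (parts u) (parts v).

(* The defining relation of the e_k, solved for its last term
   (-1)^k q^(k choose 2) e_k; see [e_rel]. *)
Fixpoint e_list q (k : nat) : seq (NL F) :=
  if k is k'.+1 then
    let s := e_list q k' in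
    rcons s (- ((-1) ^+ k * q ^+ 'C(k, 2))^-1 *:
      \sum_(i < k) ((-1) ^+ i * q ^+ 'C(i, 2)) *: (s`_i * h F (k - i)%N))
  else [:: 1].

Definition e q (k : int) : NL F :=
  match k with
  | Posz n => (e_list q n)`_n
  | Negz _ => 0
  end.

Lemma size_e_list q k : size (e_list q k) = k.+1.
Proof. by elim: k => //= k IH; rewrite size_rcons IH. Qed.

Lemma nth_e_list q (k i : nat) : (i <= k)%N -> (e_list q k)`_i = e q i.
Proof.
elim: k => [|k IH]; first by rewrite leqn0 => /eqP->.
rewrite leq_eqVlt => /predU1P[-> //|lt_ik].
by rewrite /= nth_rcons size_e_list lt_ik IH.
Qed.

Lemma e0 q : e q 0 = 1. Proof. by []. Qed.

Lemma e_rel q (k : nat) : q != 0 -> (0 < k)%N ->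
  \sum_(0 <= i < k.+1)
    ((-1) ^+ i * q ^+ 'C(i, 2)) *: (e q i * h F (k%:Z - i%:Z)) = 0.
Proof.
case: k => // k q0 _; rewrite big_nat_recr //= subrr /= mulr1.
rewrite nth_rcons size_e_list ltnn eqxx scalerA mulrN mulfV; last first.
  by rewrite mulf_neq0 ?expf_neq0 ?oppr_eq0 ?oner_eq0.
rewrite scaleN1r big_mkord; apply/eqP; rewrite subr_eq0; apply/eqP.
apply: eq_bigr => i _; have le_ik: (i <= k)%N by rewrite -ltnS.
rewrite (nth_e_list q le_ik) subzn; last exact: leqW.
reflexivity.
Qed.

(* (h_lambda, e_k x)_{h_mu}: Delta(h_lambda) is expanded in the basis of pairs
   of words. *)
Definition insertion q (mu lambda : seq int) (k : int) x : F :=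
  let D := Delta q (hs F lambda) in
  \sum_(p <- msupp D)
    D@_p * pairing q << p.1 >> (e q k) * pairing q (hs F mu * << p.2 >>) x.

End Pairing.

Definition bin_seqs (m l : nat) : {set m.-tuple bool} :=
  [set sigma : m.-tuple bool | count_mem true sigma == l].

Definition seq_of_bits (sigma : seq bool) : seq int :=
  [seq (nat_of_bool b)%:Z | b <- sigma].

Definition subs (s t : seq int) : seq int :=
  [seq p.1 - p.2 | p <- zip s t].
Definition muls (s t : seq int) : seq int :=
  [seq p.1 * p.2 | p <- zip s t].
Definition seq_sum (s : seq int) : int := \sum_(a <- s) a.
Definition psums (s : seq int) : seq int := scanl +%R 0 s.

(* Main.v *)
Require Import Defs.
From HB Require Import structures.
From mathcomp Require Import all_boot all_order all_algebra all_fingroup.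
From mathcomp Require Import zify ring.
From mathcomp Require Import finmap monalg.
From mathcomp Require Import reals complex.

Set Implicit Arguments.
Unset Strict Implicit.
Unset Printing Implicit Defensive.

Import GRing.Theory.
Local Open Scope nat_scope.

(** Think of [h_lambda] as a bundle of ribbons, the i-th one made of [lambda_i]
strands. The formula says that pairing with [e_k x] sends at most one strand of
each ribbon into [e_k] and the others into [x], every crossing of a strand going
to [x] with a later strand going to [e_k] costing a factor [q]; only the first
[m] ribbons are decided, the decision on the others being left to the insertion.

The proof turns left multiplication by [h_b] and by [e_k] in the right argument
of the form into operators acting on the left argument.

- The double cosets of two Young subgroups are the nonnegative integer matrices
  with the corresponding row and column sums, and the shortest element of a
  double coset has one inversion for each pair of units of the matrix standing
  in rows and columns of opposite order ([pairing_comp_sum]). Splitting off the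
  first column of the matrix gives [(x, h_b y) = (D_b x, y)] where [D_b] is
  [skew_h], determined by the twisted Leibniz rule
  [D_b (h_a y) = \sum_j q^((a-j)(b-j)) h_(a-j) D_(b-j) y] ([pairing_mul_h]).

- Let [E_k], here [skew_e], be the operator with the twisted Leibniz rule
  [E_k (h_a y) = q^(a k) h_a E_k y + q^((a-1)(k-1)) h_(a-1) E_(k-1) y].
  Both rules together show that [A_k = \sum_i (-1)^i q^(i choose 2) D_(k-i) E_i]
  satisfies [A_k (h_a y) = q^(a k) h_a A_k y], all other terms cancelling in
  pairs; as [A_k 1 = 0] for [k > 0], [A_k] vanishes ([alternating_eh_eq0]).
  This is dual to the relation that defines the [e_k], so that
  [(x, e_k y) = (E_k x, y)] ([pairing_mul_e]).

- Contracting the first tensor factor of [Delta x] with [e_k] is an operator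
  with the same Leibniz rule, hence is [E_k], and the insertion is
  [(h_mu E_k h_lambda, x)] ([insertionE]).

It remains to apply the Leibniz rule of [E_k] to the first [m] factors of
[h_lambda]: the two terms of the rule are the two values of an entry of the
binary sequence ([skew_e_expand]). *)

(** * Lengths of permutations *)

Section Length.
Variable N : nat.
Implicit Types (x y : 'I_N) (v w : 'S_N).

(** Applying the transposition to both members of a pair maps the inversions of
    the new permutation injectively to those of [w] other than [(x, y)], because
    a transposition of neighbours reverses the order of that pair only. *)
Lemma perm_length_tperm w x y :
  y = x.+1 :> nat -> w y < w x -> perm_length (tperm x y * w)%g < perm_length w.
Proof.
move=> yx lt_w; rewrite /perm_length.
set I := [set p : 'I_N * 'I_N | (p.1 < p.2) && (w p.2 < w p.1)].
have xyI : (x, y) \in I by rewrite inE /= yx leqnn.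
rewrite [X in _ < X](cardsD1 (x, y)) xyI add1n ltnS.
pose t (p : 'I_N * 'I_N) := (tperm x y p.1, tperm x y p.2).
have t_inj : injective t.
  by move=> [a b] [c d] [/perm_inj-> /perm_inj->].
rewrite -(card_imset _ t_inj).
apply/subset_leq_card/subsetP => p /imsetP[[a b]].
rewrite inE /= !permM => /andP[lt_ab lt_wba] {p}->.
rewrite !inE /= lt_wba andbT /t /=.
have neq_ab : ~ (a = x /\ b = y).
  by move=> [ea eb]; move: lt_wba; rewrite ea eb tpermL tpermR ltnNge ltnW.
have neqP (c d : 'I_N) : c <> d -> (c : nat) <> d by move=> ne /val_inj.
apply/andP; split.
  apply/eqP => -[ea eb]; move: lt_ab.
  have -> : a = y by rewrite -(tpermK x y a) ea tpermL.
  have -> : b = x by rewrite -(tpermK x y b) eb tpermR.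
  by rewrite yx ltnNge leqnSn.
case: tpermP => [ea|ea|/neqP nax /neqP nay];
  case: tpermP => [eb|eb|/neqP nbx /neqP nby]; subst => //;
  by [lia | case: neq_ab].
Qed.

Lemma perm_lengthV w : perm_length w^-1%g = perm_length w.
Proof.
pose t (p : 'I_N * 'I_N) := (w p.2, w p.1).
have t_inj : injective t.
  by move=> [a b] [c d] [/perm_inj-> /perm_inj->].
rewrite /perm_length -[RHS](card_imset _ t_inj).
congr #|pred_of_set _|; apply/setP => -[a b].
rewrite inE; apply/andP/imsetP => /=.
  move=> [lt_ab lt_w]; exists (w^-1 b, w^-1 a)%g; last by rewrite /t /= !permKV.
  by rewrite inE /= !permKV lt_ab lt_w.
by move=> [[c d]]; rewrite inE /= => /andP[lt_cd lt_w] [-> ->]; rewrite !permK.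
Qed.

(** The blocks are the fibres of the monotone function [f], hence intervals, on
    which it is enough to compare neighbours. *)
Lemma incr_on_blocks (f : 'I_N -> nat) w :
  {homo f : x y / x <= y} ->
  (forall x y, y = x.+1 :> nat -> f x = f y -> w x < w y) ->
  forall x y, x < y -> f x = f y -> w x < w y.
Proof.
move=> f_homo w_adj x y; move en : (y - x.+1) => n.
elim: n y en => [|n IH] y en lt_xy fxy; first by apply: w_adj => //; lia.
have lt_z : y.-1 < N by have := ltn_ord y; lia.
have fz : f x = f (Ordinal lt_z).
  by apply/eqP; rewrite eqn_leq f_homo /= ?[f x]fxy ?f_homo //=; lia.
apply: (ltn_trans (IH _ _ _ fz)) => /=; [lia|lia|].
by apply: w_adj => /=; [lia|rewrite -fz].
Qed.

End Length.

(** * Double cosets of Young subgroups and integer matrices *)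
Lemma reshape_index_cons a alpha i :
  reshape_index (a :: alpha) i =
  if i < a then 0 else (reshape_index alpha (i - a)).+1.
Proof.
by rewrite /reshape_index /= subn_eq0; case: ltnP => //= le_ai; rewrite subSn.
Qed.

Lemma homo_reshape_index alpha : {homo reshape_index alpha : i j / i <= j}.
Proof.
by move=> i j; rewrite (reshape_leq alpha) => /orP[/ltnW|/andP[/eqP->]].
Qed.

Lemma sum_reshape_index alpha (F : nat -> nat) :
  \sum_(0 <= x < sumn alpha) F (reshape_index alpha x) =
  \sum_(0 <= i < size alpha) nth 0 alpha i * F i.
Proof.
elim: alpha F => [|a alpha IH] F /=; first by rewrite !big_nil.
rewrite [RHS]big_nat_recl //= (big_cat_nat (n := a)) ?leq_addr //=.
congr (_ + _).
  under eq_big_nat => x /andP[_ lt_x] do rewrite reshape_index_cons lt_x.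
  by rewrite sum_nat_const_nat subn0.
rewrite -(IH (fun i => F i.+1)) -[X in \sum_(X <= _ < _) _]add0n big_addn.
rewrite addKn; apply: eq_bigr => x _.
by rewrite reshape_index_cons ltnNge leq_addl /= addnK.
Qed.

Lemma count_sum T (P : pred T) s : count P s = \sum_(t <- s) P t.
Proof. by elim: s => [|t s IH] /=; rewrite ?big_nil // big_cons IH. Qed.

Lemma count_mktuple n T (P : pred T) (F : 'I_n -> T) :
  count P [tuple F i | i < n] = \sum_i P (F i).
Proof.
by rewrite count_sum big_tuple; apply: eq_bigr => i _; rewrite tnth_mktuple.
Qed.

Lemma sum_delta n i0 (F : nat -> nat) :
  i0 < n -> \sum_(0 <= i < n) (i0 == i) * F i = F i0.
Proof.
move=> lt_i; rewrite big_mkord (bigD1 (Ordinal lt_i)) //= eqxx mul1n.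
rewrite big1 ?addn0 // => i; rewrite -val_eqE /= eq_sym.
by case: eqP => // _; rewrite mul0n.
Qed.

(** The number of inversions common to all permutations of a double coset with
    matrix [M]: two points must be inverted when their row blocks and their
    column blocks come in opposite orders. A matrix is the list of its columns,
    [n] being the number of rows, so that its head corresponds to the first
    factor of the right argument of the form. *)
Definition mx_inv (n : nat) (M : seq (seq nat)) : nat :=
  \sum_(0 <= j < size M) \sum_(0 <= i < n) nth 0 (nth [::] M j) i *
    \sum_(0 <= j' < size M) \sum_(0 <= i' < n) nth 0 (nth [::] M j') i' *
      ((i < i') && (j' < j)).

Section Matrix.
Variables (N : nat) (alpha beta : seq nat).
Hypotheses (alphaN : sumn alpha = N) (betaN : sumn beta = N).
Implicit Types (x y : 'I_N) (v w : 'S_N).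

Let f x := reshape_index alpha x.
Let g x := reshape_index beta x.

(** The complete invariant of the double coset of [w]: its entries count the
    points of a given row block that [w] sends to a given column block. *)
Definition coset_mx w : seq (seq nat) :=
  mkseq (fun j => mkseq (fun i => \sum_x (f x == i) * (g (w x) == j))
                        (size alpha))
        (size beta).

Lemma row_ltn x : f x < size alpha.
Proof. by apply: reshape_indexP; rewrite alphaN. Qed.
Lemma col_ltn x : g x < size beta.
Proof. by apply: reshape_indexP; rewrite betaN. Qed.

Lemma sum_row (F : nat -> nat) :
  \sum_x F (f x) = \sum_(0 <= i < size alpha) nth 0 alpha i * F i.
Proof.
rewrite -sum_reshape_index alphaN big_mkord; exact: eq_bigr.
Qed.
Lemma sum_col (F : nat -> nat) :
  \sum_x F (g x) = \sum_(0 <= i < size beta) nth 0 beta i * F i.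
Proof.
rewrite -sum_reshape_index betaN big_mkord; exact: eq_bigr.
Qed.

Lemma coset_mxE w i j : i < size alpha -> j < size beta ->
  nth 0 (nth [::] (coset_mx w) j) i = \sum_x (f x == i) * (g (w x) == j).
Proof. by move=> lt_i lt_j; rewrite nth_mkseq // nth_mkseq. Qed.

(** Summing over the points [x] is summing over the matrix entries, with [F] an
    arbitrary statistic of the two blocks of a point. Marginals, equality of
    matrices and inversion counts are all obtained by a choice of [F]. *)
Lemma sum_coset_mx w (F : nat -> nat -> nat) :
  \sum_(0 <= j < size beta) \sum_(0 <= i < size alpha)
    nth 0 (nth [::] (coset_mx w) j) i * F i j =
  \sum_x F (f x) (g (w x)).
Proof.
under eq_big_nat => j /andP[_ lt_j] do under eq_big_nat => i /andP[_ lt_i] do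
  rewrite coset_mxE // big_distrl.
under eq_bigr => j _ do rewrite exchange_big.
rewrite exchange_big; apply: eq_bigr => x _ /=.
rewrite exchange_big /= -[RHS](sum_delta (F (f x)) (col_ltn (w x))) -/f.
rewrite exchange_big; apply: eq_bigr => j _ /=.
rewrite -(sum_delta (fun i => (g (w x) == j) * F i j) (row_ltn x)).
by apply: eq_bigr => i _; rewrite mulnA.
Qed.

Lemma row_sum_coset_mx w i : i < size alpha ->
  \sum_(c <- coset_mx w) nth 0 c i = nth 0 alpha i.
Proof.
move=> lt_i; rewrite (big_nth [::]) size_mkseq.
rewrite -(sum_delta (nth 0 alpha) lt_i); under [RHS]eq_bigr do rewrite mulnC.
rewrite -(sum_row (eq_op i)) -(sum_coset_mx w (fun i' _ => i == i')).
apply: eq_bigr => j _; rewrite -(sum_delta (nth 0 _) lt_i).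
by apply: eq_bigr => i' _; rewrite mulnC.
Qed.

Lemma col_sum_coset_mx w : map sumn (coset_mx w) = beta.
Proof.
apply: (@eq_from_nth _ 0) => [|j]; first by rewrite size_map size_mkseq.
rewrite size_map size_mkseq => lt_j.
rewrite (nth_map [::]) ?size_mkseq // -(sum_delta (nth 0 beta) lt_j).
under [RHS]eq_bigr do rewrite mulnC.
rewrite -(sum_col (eq_op j)) (reindex_inj (perm_inj (s := w))) /=.
rewrite -(sum_coset_mx w (fun _ j' => j == j')).
rewrite -(sum_delta (fun j' => sumn (nth [::] (coset_mx w) j')) lt_j).
apply: eq_big_nat => j' /andP[_ lt_j']; rewrite -big_distrl mulnC /=.
congr (_ * _).
by rewrite sumnE (big_nth 0) nth_mkseq // size_mkseq.
Qed.

(** Equal matrices mean that [x |-> (f x, g (v x))] and [x |-> (f x, g (w x))]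
    take each value equally often, so that they differ by a permutation [a] of
    the points, which preserves [f]. *)
Lemma coset_mx_eqP v w : reflect
  (exists2 a, a \in Young N alpha & forall x, g (v x) = g (w (a x)))
  (coset_mx v == coset_mx w).
Proof.
apply: (iffP eqP) => [eq_vw | [a]]; last first.
  rewrite inE => /forallP fa gv.
  apply: eq_mkseq => j; apply: eq_mkseq => i.
  rewrite [RHS](reindex_inj (perm_inj (s := a))); apply: eq_bigr => x _ /=.
  by have -> : f (a x) = f x; [exact: eqP (fa x) | rewrite gv].
pose tv := [tuple (f x, g (v x)) | x < N].
pose tw := [tuple (f x, g (w x)) | x < N].
have /tuple_permP[a tv_tw] : perm_eq tv tw.
  apply/seq.permP => P.
  rewrite !count_mktuple.
  by rewrite -!(sum_coset_mx _ (fun i j => P (i, j))) eq_vw.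
have eq_a x : (f x, g (v x)) = (f (a x), g (w (a x))).
  have := congr1 (fun s => nth (0, 0) s x) tv_tw.
  by rewrite -!tnth_nth !tnth_mktuple.
exists a => [|x]; last by case: (eq_a x).
by rewrite inE; apply/forallP => x; apply/eqP; have [] := eq_a x.
Qed.

Lemma mem_double_coset v w :
  (v \in Young N alpha :* w * Young N beta)%g = (coset_mx v == coset_mx w).
Proof.
apply/idP/coset_mx_eqP.
  move=> /mulsgP[_ b /rcosetP[a aY ->] bY ->]; exists a => // x.
  move: bY; rewrite inE => /forallP/(_ (w (a x)))/eqP gb.
  by rewrite !permM; exact: gb.
move=> [a aY gv]; have -> : v = (a * w * ((a * w)^-1 * v))%g by rewrite mulKVg.
apply: mem_mulg; first by apply/rcosetP; exists a.
rewrite inE; apply/forallP => x.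
by rewrite permM -/(g _) -/(g _) gv -permM -permM mulVg perm1.
Qed.

(** Otherwise the representative, or its inverse, reverses two neighbours of one
    block; exchanging them stays in the double coset and shortens it. *)
Lemma min_rep_incr w (C := (Young N alpha :* w * Young N beta)%g) :
  [/\ min_rep C \in C,
      forall x y, x < y -> f x = f y -> min_rep C x < min_rep C y
    & forall x y, x < y -> g x = g y ->
        (min_rep C)^-1%g x < (min_rep C)^-1%g y].
Proof.
have wC : w \in C by rewrite mem_double_coset.
have rC : repr C \in C by apply: mem_repr wC.
rewrite /min_rep; case: arg_minnP => // u uC u_min.
have lt_adj (v : 'S_N) x y : y = x.+1 :> nat -> ~~ (v x < v y) -> v y < v x.
  move=> yx; rewrite -leqNgt leq_eqVlt => /predU1P[/val_inj/perm_inj eyx|//].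
  by move: yx; rewrite eyx; lia.
split=> //.
  apply: incr_on_blocks => [x y|x y yx fxy]; first exact: homo_reshape_index.
  apply/negPn/negP => /(lt_adj _ _ _ yx) lt_u.
  have /u_min : (tperm x y * u)%g \in C.
    rewrite mem_double_coset in uC; rewrite mem_double_coset -(eqP uC).
    apply/coset_mx_eqP; exists (tperm x y) => [|z]; last by rewrite permM.
    rewrite inE; apply/forallP => z; rewrite -/(f _) -/(f z).
    by case: tpermP => // ->; rewrite ?fxy.
  by rewrite leqNgt perm_length_tperm.
apply: incr_on_blocks => [x y|x y yx gxy]; first exact: homo_reshape_index.
apply/negPn/negP => /(lt_adj _ _ _ yx) lt_u.
have /u_min : (u * tperm x y)%g \in C.
  rewrite mem_double_coset in uC; rewrite mem_double_coset -(eqP uC).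
  apply/coset_mx_eqP; exists 1%g => [|z]; first exact: group1.
  by rewrite permM perm1; case: tpermP => // ->.
rewrite -(perm_lengthV u) -(perm_lengthV (u * _)%g) invMg tpermV leqNgt.
by rewrite perm_length_tperm.
Qed.

(** By monotonicity on the blocks, the minimal representative has no inversion
    besides those that the blocks force. *)
Lemma perm_length_min_rep w (C := (Young N alpha :* w * Young N beta)%g) :
  perm_length (min_rep C) = mx_inv (size alpha) (coset_mx w).
Proof.
have [uC u_f u_g] := min_rep_incr w; rewrite -/C in uC u_f u_g.
move: uC; rewrite mem_double_coset => /eqP <-.
move: (min_rep C) u_f u_g => u u_f u_g.
rewrite /mx_inv size_mkseq.
under eq_bigr => j _ do under eq_bigr => i _ do
  rewrite (sum_coset_mx u (fun i' j' => ((i < i') && (j' < j)) : nat)).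
rewrite (sum_coset_mx u (fun i j => \sum_x ((i < f x) && (g (u x) < j)) : nat)).
rewrite /perm_length -sum1_card pair_big /= big_mkcond /=.
apply: eq_bigr => -[x y] _; rewrite inE /=.
have -> : (x < y) && (u y < u x) = (f x < f y) && (g (u y) < g (u x)).
  apply/andP/andP => -[]; last first.
    have homo_lt al (a b : nat) :
        reshape_index al a < reshape_index al b -> a < b.
      by rewrite !ltnNge; apply: contra; apply: homo_reshape_index.
    by move=> /homo_lt lt_xy /homo_lt lt_u.
  move=> lt_xy lt_u; split.
    rewrite ltn_neqAle [_ <= _]homo_reshape_index ?andbT; last exact: ltnW.
    by apply/eqP => /(u_f _ _ lt_xy); rewrite ltnNge ltnW.
  rewrite ltn_neqAle [_ <= _]homo_reshape_index ?andbT; last exact: ltnW.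
  by apply/eqP => /(u_g _ _ lt_u); rewrite !permK ltnNge ltnW.
by case: andP.
Qed.

(** List the pairs [(i, j)] with the multiplicities prescribed by [M]. Their
    first components are a rearrangement [p1] of the row blocks of the points
    and their second ones a rearrangement [p2] of the column blocks; matching
    the two rearrangements gives the permutation. *)
Lemma coset_mx_onto (M : seq (seq nat)) :
  size M = size beta -> all (fun c => size c == size alpha) M ->
  (forall j, j < size beta -> sumn (nth [::] M j) = nth 0 beta j) ->
  (forall i, i < size alpha -> \sum_(c <- M) nth 0 c i = nth 0 alpha i) ->
  exists w, coset_mx w = M.
Proof.
move=> szM /allP/= szc Mcol Mrow.
have szMj j : j < size beta -> size (nth [::] M j) = size alpha.
  by move=> lt_j; apply/eqP/szc/mem_nth; rewrite szM.
pose s := flatten [seq nseq (nth 0 (nth [::] M j) i) (i, j) |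
                     j <- iota 0 (size beta), i <- iota 0 (size alpha)].
have sE (P : pred (nat * nat)) : count P s =
    \sum_(0 <= j < size beta) \sum_(0 <= i < size alpha)
      nth 0 (nth [::] M j) i * P (i, j).
  rewrite count_flatten sumnE big_map big_allpairs_dep /index_iota !subn0.
  by apply: eq_bigr => j _; apply: eq_bigr => i _; rewrite count_nseq mulnC.
have s1 : perm_eq (unzip1 s) [tuple f x | x < N].
  apply/seq.permP => P; rewrite count_map sE exchange_big /=.
  rewrite count_mktuple (sum_row P); apply: eq_big_nat => i /andP[_ lt_i].
  by rewrite -big_distrl /= -Mrow // (big_nth [::]) szM.
have s2 : perm_eq (unzip2 s) [tuple g x | x < N].
  apply/seq.permP => P; rewrite count_map sE /=.
  rewrite count_mktuple (sum_col P); apply: eq_big_nat => j /andP[_ lt_j].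
  by rewrite -big_distrl /= -Mcol // sumnE [in RHS](big_nth 0) szMj.
have /tuple_permP[p1 {}s1] := s1; have /tuple_permP[p2 {}s2] := s2.
have sz_s : size s = N by rewrite -(size_map fst) -/(unzip1 s) s1 size_tuple.
have fs x : (nth (0, 0) s x).1 = f (p1 x).
  rewrite -(nth_map _ 0) ?sz_s // -/(unzip1 s) s1.
  by rewrite -tnth_nth !tnth_mktuple.
have gs x : (nth (0, 0) s x).2 = g (p2 x).
  rewrite -(nth_map _ 0) ?sz_s // -/(unzip2 s) s2.
  by rewrite -tnth_nth !tnth_mktuple.
exists (p1^-1 * p2)%g; apply: (@eq_from_nth _ [::]) => [|j].
  by rewrite size_mkseq.
rewrite size_mkseq => lt_j.
apply: (@eq_from_nth _ 0) => [|i].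
  by rewrite nth_mkseq // size_mkseq szMj.
rewrite nth_mkseq // size_mkseq => lt_i; rewrite nth_mkseq //.
rewrite (reindex_inj (perm_inj (s := p1))) /=.
under eq_bigr do rewrite permM permK -fs -gs mulnb.
have := sE (fun p => (p.1 == i) && (p.2 == j)).
rewrite count_sum (big_nth (0, 0)) sz_s big_mkord => ->.
rewrite -(sum_delta (fun j' => nth 0 (nth [::] M j') i) lt_j).
apply: eq_bigr => j' _.
rewrite -(sum_delta (fun i' => (j == j') * nth 0 (nth [::] M j') i') lt_i).
apply: eq_bigr => i' _; rewrite /= -mulnb.
by rewrite [i' == i]eq_sym [j' == j]eq_sym mulnC mulnA.
Qed.

End Matrix.

Definition subv (alpha delta : seq nat) : seq nat :=
  [seq p.1 - p.2 | p <- zip alpha delta].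

(** The ways of choosing [b] strands from ribbons of sizes [alpha]. *)
Fixpoint subvectors (alpha : seq nat) (b : nat) : seq (seq nat) :=
  if alpha is a :: alpha' then
    [seq j :: delta | j <- [seq j <- iota 0 b.+1 | j <= a],
                      delta <- subvectors alpha' (b - j)]
  else if b is 0 then [:: [::]] else [::].

Lemma subvectors_cons a alpha b :
  subvectors (a :: alpha) b =
  [seq j :: delta | j <- [seq j <- iota 0 b.+1 | j <= a],
                    delta <- subvectors alpha (b - j)].
Proof. by []. Qed.

(** The matrices with row sums [alpha] and column sums [beta], built column by
    column so as to follow the factors of [h_beta]. *)
Fixpoint margin_mxs (alpha beta : seq nat) : seq (seq (seq nat)) :=
  if beta is b :: beta' then
    [seq delta :: M | delta <- subvectors alpha b,
                      M <- margin_mxs (subv alpha delta) beta']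
  else if all (pred1 0) alpha then [:: [::]] else [::].

(** The number of crossings of a strand that is kept ([rho]) with a strand that
    is removed ([delta]) from a later ribbon. *)
Definition crossing (rho delta : seq nat) : nat :=
  \sum_(0 <= i < size rho) nth 0 rho i *
    \sum_(0 <= i' < size rho) nth 0 delta i' * (i < i').

Lemma subvectorsP alpha b delta : reflect
  [/\ size delta = size alpha, sumn delta = b &
      forall i, i < size alpha -> nth 0 delta i <= nth 0 alpha i]
  (delta \in subvectors alpha b).
Proof.
elim: alpha b delta => [|a alpha IH] b delta; last rewrite subvectors_cons.
  by case: b => [|b]; case: delta => [|d delta]; constructor; try case.
apply: (iffP allpairsPdep) => [[j [d [+ /IH[sz_d sum_d le_d] ->]]]|].
  rewrite mem_filter mem_iota add0n /= => /andP[le_ja lt_jb].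
  by split=> [||[|i]] /=; [rewrite sz_d | rewrite sum_d subnKC | | apply: le_d].
case: delta => [|d delta] [] // [sz_d] sum_d le_d.
have {}sum_d : d + sumn delta = b := sum_d.
exists d, delta; split=> //; last first.
  by apply/IH; split=> // [|i]; [lia | apply: (le_d i.+1)].
by rewrite mem_filter mem_iota [_ <= _](le_d 0 isT); lia.
Qed.

Lemma uniq_subvectors alpha b : uniq (subvectors alpha b).
Proof.
elim: alpha b => [|a alpha IH] b; [by case: b | rewrite subvectors_cons].
apply: allpairs_uniq_dep => [|j _|]; rewrite ?filter_uniq ?iota_uniq //.
by move=> [j d] [j' d'] _ _ /= [<- <-].
Qed.

Lemma size_subv alpha delta :
  size delta = size alpha -> size (subv alpha delta) = size alpha.
Proof. by move=> sz; rewrite size_map size_zip sz minnn. Qed.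

Lemma nth_subv alpha delta i : size delta = size alpha ->
  nth 0 (subv alpha delta) i = nth 0 alpha i - nth 0 delta i.
Proof.
elim: alpha delta i => [|a alpha IH] [|d delta] [|i] //= [sz].
exact: IH.
Qed.

Lemma margin_mxsP alpha beta M : reflect
  [/\ all (fun c => size c == size alpha) M, map sumn M = beta &
      forall i, i < size alpha -> \sum_(c <- M) nth 0 c i = nth 0 alpha i]
  (M \in margin_mxs alpha beta).
Proof.
elim: beta alpha M => [|b beta IH] alpha M /=.
  case: ifPn => [/(all_nthP 0) al0 | /(all_nthP 0) al0]; last first.
    constructor=> -[_ /eqP]; case: M => // _ sumM; apply: al0 => i /sumM.
    by rewrite big_nil => <-.
  rewrite inE; apply: (iffP eqP) => [->|[_ /eqP]]; last by case: M.
  by split=> // i lt_i; rewrite big_nil (eqP (al0 i lt_i)).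
apply: (iffP allpairsPdep).
  move=> [d [M' [/subvectorsP[sz_d sum_d le_d] /IH[sz_M sum_M row_M] ->]]].
  rewrite size_subv // in sz_M row_M; split=> [||i lt_i] /=.
  - by rewrite sz_d eqxx.
  - by rewrite sum_d sum_M.
  - by rewrite big_cons row_M // nth_subv // subnKC // le_d.
case: M => [|d M] [] //= /andP[/eqP sz_d sz_M] [sum_d sum_M] row_M.
exists d, M; split=> //.
  by apply/subvectorsP; split=> // i /row_M <-; rewrite big_cons leq_addr.
apply/IH; rewrite size_subv //; split=> // i lt_i.
by rewrite nth_subv // -row_M // big_cons addKn.
Qed.

Lemma uniq_margin_mxs alpha beta : uniq (margin_mxs alpha beta).
Proof.
elim: beta alpha => [|b beta IH] alpha /=; first by case: ifP.
apply: allpairs_uniq_dep => [|d _|]; rewrite ?uniq_subvectors //.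
by move=> [j d] [j' d'] _ _ /= [<- <-].
Qed.

Lemma sumn_margin alpha beta M :
  M \in margin_mxs alpha beta -> sumn beta = sumn alpha.
Proof.
move=> /margin_mxsP[/allP/= sz_M <- row_M].
rewrite sumnE big_map [RHS]sumnE (big_nth 0).
under [RHS]eq_big_nat => i /andP[_ lt_i] do rewrite -row_M //.
rewrite exchange_big /= big_seq [RHS]big_seq; apply: eq_bigr => c /sz_M/eqP <-.
by rewrite sumnE (big_nth 0).
Qed.

(** The inversions that involve the first column depend on the other columns
    only through their row sums. *)
Lemma mx_inv_cons alpha b beta d M :
  d \in subvectors alpha b -> M \in margin_mxs (subv alpha d) beta ->
  mx_inv (size alpha) (d :: M) =
  crossing (subv alpha d) d + mx_inv (size alpha) M.
Proof.
move=> /subvectorsP[sz_d _ _] /margin_mxsP[_ _].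
rewrite /mx_inv /= big_nat_recl //= size_subv // => row_M.
rewrite big1 ?add0n => [|i _]; last first.
  rewrite big1 ?muln0 // => j _; rewrite big1 // => i' _.
  by rewrite ltn0 andbF muln0.
under eq_bigr => j _ do under eq_bigr => i _ do
  rewrite big_nat_recl //= mulnDr.
under eq_bigr => j _ do rewrite big_split.
rewrite big_split /= exchange_big /crossing size_subv //; congr (_ + _).
apply: eq_big_nat => i /andP[_ lt_i]; rewrite -row_M //.
rewrite [in RHS](big_nth [::]) big_distrl /=; apply: eq_bigr => j _.
by congr (_ * _); apply: eq_bigr => i' _; rewrite andbT.
Qed.

Local Open Scope ring_scope.

(** Double cosets correspond bijectively to matrices, which determine the
    shortest lengths. Zero parts are allowed in the compositions because
    removing strands may exhaust a ribbon. *)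
Lemma pairing_comp_sum (F : fieldType) (q : F) alpha beta :
  pairing_comp q alpha beta =
  \sum_(M <- margin_mxs alpha beta) q ^+ mx_inv (size alpha) M.
Proof.
rewrite /pairing_comp; case: eqP => [betaN|neqN]; last first.
  by rewrite big_seq big1 // => M /sumn_margin.
set N := sumn alpha in betaN *; set Ya := Young N alpha; set Yb := Young N beta.
pose cm (C : {set 'S_N}) := coset_mx alpha beta (repr C).
have cmE w : cm (Ya :* w * Yb)%g = coset_mx alpha beta w.
  apply/eqP; rewrite -(mem_double_coset (erefl N) betaN).
  have wC : w \in (Ya :* w * Yb)%g.
    by rewrite (mem_double_coset (erefl N) betaN).
  exact: mem_repr wC.
transitivity (\sum_(M <- [seq cm C | C <- enum (double_cosets Ya Yb)])
                q ^+ mx_inv (size alpha) M).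
  rewrite big_map big_enum; apply: eq_bigr => C /imsetP[w _ ->].
  by rewrite (perm_length_min_rep (erefl N) betaN) cmE.
apply: perm_big; apply: uniq_perm (uniq_margin_mxs _ _) _ => [|M].
  rewrite map_inj_in_uniq ?enum_uniq // => C C'.
  rewrite !mem_enum => /imsetP[w _ ->] /imsetP[w' _ ->]; rewrite !cmE => eq_w.
  by apply/setP => v; rewrite !(mem_double_coset (erefl N) betaN) eq_w.
apply/mapP/margin_mxsP => [[C]|[sz_M sum_M row_M]].
  rewrite mem_enum => /imsetP[w _ ->] ->; rewrite cmE; split.
  - by apply/allP => c /mapP[j _ ->]; rewrite size_mkseq.
  - exact: col_sum_coset_mx.
  - by move=> i; apply: row_sum_coset_mx.
have [||w <-] := coset_mx_onto (erefl N) betaN _ sz_M _ row_M.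
- by rewrite -sum_M size_map.
- by move=> j lt_j; rewrite -sum_M (nth_map [::]) // -(size_map sumn) sum_M.
exists (Ya :* w * Yb)%g; last by rewrite cmE.
by rewrite mem_enum; apply: imset_f.
Qed.

(** * Linear maps on free modules *)
Section Extend.
Variables (F : fieldType) (K : choiceType) (V : lmodType F) (f : K -> V).

Definition extend (x : {malg F[K]}) : V := \sum_(u <- msupp x) x@_u *: f u.

Lemma extendEw (d : {fset K}) x : (msupp x `<=` d)%fset ->
  extend x = \sum_(u <- d) x@_u *: f u.
Proof.
move=> le_d; rewrite /extend (big_fset_incl _ le_d) // => u _ /mcoeff_outdom ->.
by rewrite scale0r.
Qed.

Fact extend_is_linear : linear extend.
Proof.
move=> c x y; pose d := (msupp x `|` msupp y)%fset.
have le_x : (msupp x `<=` d)%fset by apply: fsubsetUl.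
have le_y : (msupp y `<=` d)%fset by apply: fsubsetUr.
have le_xy : (msupp (c *: x + y) `<=` d)%fset.
  apply: fsubset_trans (msuppD_le _ _) _; apply: fsetSU; apply: msuppZ_le.
rewrite !(extendEw le_x, extendEw le_y, extendEw le_xy).
rewrite scaler_sumr -big_split; apply: eq_bigr => u _ /=.
by rewrite mcoeffD mcoeffZ scalerDl scalerA.
Qed.

Lemma extendU u : extend << u >> = f u.
Proof. by rewrite (extendEw msuppU_le) big_seq_fset1 mcoeffUU scale1r. Qed.

End Extend.

Lemma malgU_scale (F : fieldType) (K : choiceType) (c : F) (u : K) :
  << c *g u >> = c *: << u >>.
Proof. by apply/malgP => v; rewrite mcoeffZ !mcoeffU mulrnAr mulr1. Qed.

Lemma malg_expand (F : fieldType) (K : choiceType) (x : {malg F[K]}) :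
  x = \sum_(u <- msupp x) x@_u *: << u >>.
Proof.
by rewrite {1}[x]monalgE; apply: eq_bigr => u _; rewrite malgU_scale.
Qed.

Lemma malg_scalerAr (F : fieldType) (K : monomType) (c : F)
    (x y : {malg F[K]}) :
  x * (c *: y) = c *: (x * y).
Proof.
apply/malgP => w; rewrite mcoeffZ.
rewrite (mcoeffMlw w (fsubset_refl _) (msuppZ_le c y)).
rewrite (mcoeffMlw w (fsubset_refl (msupp x)) (fsubset_refl (msupp y))).
rewrite mulr_sumr; apply: eq_bigr => u _.
rewrite mulr_sumr; apply: eq_bigr => v _.
by rewrite mcoeffZ mulrCA mulrnAr.
Qed.

Section LinearMaps.
Variables (F : fieldType) (U V W : lmodType F).

Lemma linear_0f : linear (fun _ : U => 0 : V).
Proof. by move=> c x y; rewrite scaler0 addr0. Qed.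

Lemma linear_Df (f g : U -> V) :
  linear f -> linear g -> linear (fun x => f x + g x).
Proof. by move=> fP gP c x y; rewrite fP gP scalerDr addrACA. Qed.

Lemma linear_Zf (c : F) (f : U -> V) : linear f -> linear (fun x => c *: f x).
Proof. by move=> fP d x y; rewrite fP scalerDr !scalerA mulrC. Qed.

Lemma linear_sumf (I : Type) (r : seq I) (f : I -> U -> V) :
  (forall i, linear (f i)) -> linear (fun x => \sum_(i <- r) f i x).
Proof.
move=> fP c x y; rewrite scaler_sumr -big_split /=.
by apply: eq_bigr => i _; rewrite fP.
Qed.

Lemma linear_at0 (f : U -> V) : linear f -> f 0 = 0.
Proof. by move=> fP; rewrite -[0](addNr 0) -scaleN1r fP scaleN1r addNr. Qed.

Lemma linear_app_sum (I : Type) (r : seq I) (x : I -> U) (f : U -> V) :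
  linear f -> f (\sum_(i <- r) x i) = \sum_(i <- r) f (x i).
Proof.
move=> fP; elim/big_rec2: _ => [|i _ y _ <-]; first exact: linear_at0.
by rewrite -{1}[x i]scale1r fP scale1r.
Qed.

Lemma linear_scale (a : F) (x : U) (f : U -> V) :
  linear f -> f (a *: x) = a *: f x.
Proof. by move=> fP; rewrite -[a *: x]addr0 fP linear_at0 // addr0. Qed.

Lemma linear_sum_scale (I : Type) (r : seq I) (c : I -> F) (x : I -> U)
    (f : U -> V) : linear f ->
  f (\sum_(i <- r) c i *: x i) = \sum_(i <- r) c i *: f (x i).
Proof.
move=> fP; rewrite (linear_app_sum _ _ fP).
by apply: eq_bigr => i _; rewrite linear_scale.
Qed.

Lemma linear_scale2 (a b : F) (x y : U) (f : U -> V) : linear f ->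
  f (a *: x + b *: y) = a *: f x + b *: f y.
Proof. by move=> fP; rewrite fP linear_scale. Qed.

Lemma linear_comp (f : V -> W) (g : U -> V) :
  linear f -> linear g -> linear (fun x => f (g x)).
Proof. by move=> fP gP c x y; rewrite gP fP. Qed.

End LinearMaps.

Lemma linear_mull (F : fieldType) (K : monomType) (y : {malg F[K]}) :
  linear ( *%R y).
Proof. by move=> c x z; rewrite mulrDr malg_scalerAr. Qed.

Lemma eq_linear_malg (F : fieldType) (K : choiceType) (V : lmodType F)
    (f g : {malg F[K]} -> V) :
  linear f -> linear g -> (forall u, f << u >> = g << u >>) -> f =1 g.
Proof.
move=> f_lin g_lin fg x.
rewrite (malg_expand x) !linear_sum_scale //.
by apply: eq_bigr => u _; rewrite fg.
Qed.

Lemma linear_mulr (F : fieldType) (K : monomType) (y : {malg F[K]}) :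
  linear (fun x => x * y).
Proof. by move=> c x z; rewrite mulrDl -scalerAl. Qed.

(** * Removing strands: the adjoint of multiplication by [h_b] *)
Section Operators.
Variable F : fieldType.
Implicit Types (q : F) (x y : NL F) (u v : word) (alpha beta : seq nat).

(** The word of [h_n]; it is empty for [n = 0] since [h_0 = 1]. *)
Definition hword (n : nat) : word := if n is m.+1 then fmu m else mone.

Lemma h_hword n : h F n%:Z = << hword n >>.
Proof. by case: n. Qed.

Lemma mulU u v : (<< u >> : NL F) * << v >> = << mmul u v >>.
Proof. by rewrite malgM_def fgmulUU mulr1. Qed.

Lemma word_consE n u : << mmul (fmu n) u >> = h F n.+1%:Z * << u >>.
Proof. by rewrite -mulU. Qed.

Lemma parts1 : parts mone = [::].
Proof. by rewrite /parts fm1. Qed.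

Lemma parts_cons n v : parts (mmul (fmu n) v) = n.+1 :: parts v.
Proof. by rewrite /parts fmM fmU. Qed.

Lemma word_ind (P : word -> Prop) :
  P mone -> (forall n u, P u -> P (mmul (fmu n) u)) -> forall u, P u.
Proof.
move=> P1 Pcons [s].
have -> : FMonom s = foldr (fun n u => mmul (fmu n) u) mone s.
  apply/eqP; rewrite fmP; elim: s => [|n s /eqP IH] /=; rewrite ?fm1 //.
  by rewrite fmM fmU -IH.
by elim: s => //= n s; apply: Pcons.
Qed.

Definition hseq alpha : NL F := \prod_(a <- alpha) h F a%:Z.

Lemma hs_hseq alpha : hs F [seq a%:Z | a <- alpha] = hseq alpha.
Proof. by rewrite /hs big_map. Qed.

Lemma hseq_cons a alpha : hseq (a :: alpha) = h F a%:Z * hseq alpha.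
Proof. exact: big_cons. Qed.

Lemma hseq_parts u : hseq (parts u) = << u >>.
Proof.
elim/word_ind: u => [|n u IH]; first by rewrite parts1 /hseq big_nil.
by rewrite parts_cons hseq_cons IH h_hword mulU.
Qed.

(** The truncated subtractions are harmless: [h_(a-j)] is zero when [j > a]. *)
Fixpoint skew_h_seq q b alpha : NL F :=
  if alpha is a :: alpha' then
    \sum_(j < b.+1) q ^+ ((a - j) * (b - j)) *:
      (h F (a%:Z - j%:Z) * skew_h_seq q (b - j)%N alpha')
  else (b == 0%N)%:R.

Definition skew_h q b x : NL F := extend (fun u => skew_h_seq q b (parts u)) x.

Fact skew_h_is_linear q b : linear (skew_h q b).
Proof. exact: extend_is_linear. Qed.

Lemma skew_hU q b u : skew_h q b << u >> = skew_h_seq q b (parts u).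
Proof. exact: extendU. Qed.

Lemma skew_h1 q b : skew_h q b 1 = (b == 0%N)%:R.
Proof. by rewrite skew_hU parts1. Qed.

Lemma predz n : n.+1%:Z - 1 = n%:Z.
Proof. by rewrite intS addrAC subrr add0r. Qed.

Lemma hN n : (0 < n)%N -> h F (- n%:Z) = 0.
Proof. by case: n. Qed.

(** The rule also holds for [a = 0], which is not the size of a letter. That is
    what makes it insensitive to the zero parts that [h_0 = 1] makes invisible
    in words. *)
Lemma skew_h_mul q b (a : nat) y :
  skew_h q b (h F a%:Z * y) =
  \sum_(j < b.+1) q ^+ ((a - j) * (b - j)) *:
    (h F (a%:Z - j%:Z) * skew_h q (b - j)%N y).
Proof.
pose f y := skew_h q b (h F a%:Z * y).
pose g y := \sum_(j < b.+1) q ^+ ((a - j) * (b - j)) *: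
    (h F (a%:Z - j%:Z) * skew_h q (b - j)%N y).
apply: (@eq_linear_malg _ _ _ f g) => [||v].
- exact: linear_comp (skew_h_is_linear q b) (linear_mull _).
- apply: linear_sumf => j; apply: linear_Zf.
  exact: linear_comp (linear_mull _) (skew_h_is_linear q _).
rewrite /f /g; case: a {f g} => [|a]; last rewrite h_hword mulU.
  rewrite big_ord_recl big1 => [|j _]; last first.
    by rewrite sub0r hN // mul0r scaler0.
  by rewrite addr0 sub0n mul0n expr0 scale1r subr0 !mul1r subn0.
rewrite skew_hU parts_cons; apply: eq_bigr => j _.
by rewrite skew_hU.
Qed.

Lemma crossing_cons r rho d delta : size rho = size delta ->
  crossing (r :: rho) (d :: delta) = (r * sumn delta + crossing rho delta)%N.
Proof.
move=> sz; rewrite /crossing /= big_nat_recl //= big_nat_recl //= muln0 add0n.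
congr (_ * _ + _)%N.
  rewrite sumnE [in RHS](big_nth 0%N) -sz.
  by apply: eq_bigr => i _; rewrite muln1.
by apply: eq_bigr => i _; rewrite big_nat_recl //= muln0 add0n.
Qed.

Lemma skew_h_hseq q b alpha :
  skew_h q b (hseq alpha) =
  \sum_(delta <- subvectors alpha b)
    q ^+ crossing (subv alpha delta) delta *: hseq (subv alpha delta).
Proof.
elim: alpha b => [|a alpha IH] b.
  rewrite /hseq big_nil skew_h1; case: b => [|b]; last by rewrite big_nil.
  by rewrite big_seq1 /crossing !big_nil scale1r.
rewrite hseq_cons skew_h_mul subvectors_cons big_allpairs_dep big_filter /=.
rewrite -[0%N :: iota 1 b]/(iota 0 b.+1) -[iota 0 b.+1]/(index_iota 0 b.+1).
rewrite [RHS]big_mkcond [RHS]big_mkord; apply: eq_bigr => j _.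
case: ifPn => [le_ja|].
  rewrite IH (linear_sum_scale _ _ _ (linear_mull (h F (a%:Z - j%:Z)))).
  rewrite scaler_sumr [LHS]big_seq [RHS]big_seq.
  apply: eq_bigr => d /subvectorsP[sz_d sum_d _].
  have -> : crossing (subv (a :: alpha) ((j : nat) :: d)) ((j : nat) :: d) =
      ((a - j) * (b - j) + crossing (subv alpha d) d)%N.
    by rewrite [subv _ _]/= crossing_cons ?size_subv ?sum_d.
  rewrite -[subv (a :: _) _]/((a - j)%N :: subv alpha d) (hseq_cons (a - j)).
  rewrite -(subzn le_ja) (exprD q); exact: scalerA.
rewrite -ltnNge => lt_aj; rewrite -opprB subzn ?(ltnW lt_aj) // hN ?subn_gt0 //.
by rewrite mul0r scaler0.
Qed.

Lemma skew_h0 q x : skew_h q 0 x = x.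
Proof.
apply: (@eq_linear_malg _ _ _ (skew_h q 0) id) => {x} [||u] //.
  exact: skew_h_is_linear.
elim/word_ind: u => [|n u IH]; first by rewrite skew_h1.
by rewrite word_consE skew_h_mul big_ord1 subn0 muln0 scale1r subr0 IH.
Qed.

(** Pairing with [h_beta], read as successive removals of strands; what is left
    at the end is paired with [1]. *)
Fixpoint pair_h q beta x : F :=
  if beta is b :: beta' then pair_h q beta' (skew_h q b x) else x@_mone.

Lemma pair_h_is_linear q beta : linear (pair_h q beta : NL F -> F^o).
Proof.
elim: beta => [|b beta IH] c x y /=; first by rewrite mcoeffD mcoeffZ.
by rewrite skew_h_is_linear IH.
Qed.

Lemma coef1_hmul n y : (h F n.+1%:Z * y)@_mone = 0.
Proof.
rewrite h_hword /=; pose f x := (<< fmu n >> * x)@_mone : F^o.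
apply: (@eq_linear_malg _ _ _ f (fun=> 0)) => [c x z||v].
- by rewrite /f mulrDr malg_scalerAr mcoeffD mcoeffZ.
- exact: linear_0f.
by rewrite /f mulU mcoeffU1 fmM_eq1 fm1_eq1.
Qed.

Lemma hseq_coef1 alpha : (hseq alpha)@_mone = (all (pred1 0%N) alpha)%:R.
Proof.
elim: alpha => [|[|a] alpha IH]; rewrite ?hseq_cons.
- by rewrite /hseq big_nil mcoeff1 eqxx.
- by rewrite mul1r IH.
exact: coef1_hmul.
Qed.

(** Both sides expand along the columns of the matrices: removing the first part
    of [beta] chooses the first column. *)
Lemma pair_h_hseq q alpha beta :
  pair_h q beta (hseq alpha) = pairing_comp q alpha beta.
Proof.
rewrite pairing_comp_sum; elim: beta alpha => [|b beta IH] alpha /=.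
  rewrite hseq_coef1; case: ifP => _; last by rewrite big_nil.
  by rewrite big_seq1 /mx_inv big_nil.
rewrite skew_h_hseq big_allpairs_dep.
rewrite (linear_sum_scale _ _ _ (pair_h_is_linear q beta)) !big_seq.
apply: eq_bigr => d d_sub; have [sz_d _ _] := subvectorsP _ _ _ d_sub.
rewrite IH size_subv // scaler_sumr !big_seq; apply: eq_bigr => M M_in.
by rewrite (mx_inv_cons d_sub M_in) exprD.
Qed.

Lemma pairingE q x y : pairing q x y =
  extend (fun v => extend (fun u => pairing_comp q (parts u) (parts v) : F^o) x
                   : F^o) y.
Proof.
rewrite /pairing /extend exchange_big; apply: eq_bigr => v _ /=.
rewrite scaler_sumr; apply: eq_bigr => u _.
by rewrite scalerA [_ * y@_v]mulrC.
Qed.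

Lemma pairingU q x v : pairing q x << v >> = pair_h q (parts v) x.
Proof.
rewrite pairingE extendU; move: x.
apply: (@eq_linear_malg _ _ F^o) => [||u].
- exact: extend_is_linear.
- exact: pair_h_is_linear.
by rewrite extendU -hseq_parts pair_h_hseq.
Qed.

Fact pairing_is_linear q x : linear (pairing q x : NL F -> F^o).
Proof. by move=> c y z; rewrite !pairingE extend_is_linear. Qed.

Lemma pairing_is_linear_l q y : linear (pairing q ^~ y : NL F -> F^o).
Proof.
move=> c x z; move: y; apply: (@eq_linear_malg _ _ F^o) => [||v].
- exact: pairing_is_linear.
- move=> d y y'; rewrite !pairing_is_linear.
  by rewrite !scalerDr !scalerA [d * c]mulrC addrACA.
by rewrite !pairingU pair_h_is_linear.
Qed.

(** The adjunction holds by definition of [pair_h], once the form has been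
    identified with it; the factor [h_0 = 1] is matched by [skew_h0]. *)
Lemma pairing_mul_h q x b y :
  pairing q x (h F b%:Z * y) = pairing q (skew_h q b x) y.
Proof.
case: b => [|b]; first by rewrite mul1r skew_h0.
move: y; apply: (@eq_linear_malg _ _ F^o) => [||v].
- exact: linear_comp (pairing_is_linear q x) (linear_mull _).
- exact: pairing_is_linear.
by rewrite h_hword mulU !pairingU parts_cons.
Qed.

End Operators.

(** * The adjoint of multiplication by [e_k] *)
Section SkewE.
Variable F : fieldType.
Implicit Types (q : F) (x y : NL F) (u v : word) (alpha : seq nat) (k : int).

(** The index is an integer so that the rule needs no case distinction: the
    operators of negative index are zero ([skew_e_neg]), as is [h_(-1)]. *)
Fixpoint skew_e_seq q k alpha : NL F :=
  if alpha is a :: alpha' then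
    q ^ (a%:Z * k) *: (h F a%:Z * skew_e_seq q k alpha') +
    q ^ ((a%:Z - 1) * (k - 1)) *: (h F (a%:Z - 1) * skew_e_seq q (k - 1) alpha')
  else (k == 0)%:R.

Definition skew_e q k x : NL F := extend (fun u => skew_e_seq q k (parts u)) x.

Fact skew_e_is_linear q k : linear (skew_e q k).
Proof. exact: extend_is_linear. Qed.

Lemma skew_e1 q k : skew_e q k 1 = (k == 0)%:R.
Proof. by rewrite [skew_e _ _ _]extendU parts1. Qed.

Lemma skew_e_mul q k (a : nat) y :
  skew_e q k (h F a%:Z * y) =
    q ^ (a%:Z * k) *: (h F a%:Z * skew_e q k y) +
    q ^ ((a%:Z - 1) * (k - 1)) *: (h F (a%:Z - 1) * skew_e q (k - 1) y).
Proof.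
pose f y := skew_e q k (h F a%:Z * y).
pose g y := q ^ (a%:Z * k) *: (h F a%:Z * skew_e q k y) +
    q ^ ((a%:Z - 1) * (k - 1)) *: (h F (a%:Z - 1) * skew_e q (k - 1) y).
apply: (@eq_linear_malg _ _ _ f g) => [||v].
- exact: linear_comp (skew_e_is_linear q k) (linear_mull _).
- by apply: linear_Df; apply: linear_Zf; apply: linear_comp (linear_mull _) _;
    apply: skew_e_is_linear.
rewrite /f /g; case: a {f g} => [|a]; last first.
  by rewrite h_hword mulU [LHS]extendU parts_cons /skew_e !extendU.
by rewrite mul0r expr0z scale1r sub0r hN // mul0r scaler0 addr0 !mul1r.
Qed.

Lemma skew_e_neg q (n : nat) x : skew_e q (Negz n) x = 0.
Proof.
apply: (@eq_linear_malg _ _ _ (skew_e q (Negz n)) (fun=> 0)) => {x} [||u].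
- exact: skew_e_is_linear.
- exact: linear_0f.
elim/word_ind: u n => [|m u IH] n; first by rewrite skew_e1.
rewrite word_consE skew_e_mul IH.
have -> : Negz n - 1 = Negz n.+1 by rewrite !NegzE -opprD -PoszD addn1.
by rewrite IH !mulr0 !scaler0 addr0.
Qed.

Lemma skew_e0 q x : skew_e q 0 x = x.
Proof.
apply: (@eq_linear_malg _ _ _ (skew_e q 0) id) => {x} [||u] //.
  exact: skew_e_is_linear.
elim/word_ind: u => [|n u IH]; first by rewrite skew_e1.
rewrite word_consE skew_e_mul mulr0 expr0z scale1r IH.
by rewrite sub0r -[- 1]/(Negz 0) skew_e_neg mulr0 scaler0 addr0.
Qed.

Definition eh_coef q (i : nat) : F := (-1) ^+ i * q ^+ 'C(i, 2).

(** Adjoint to multiplication by the left-hand side of the relation that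
    defines [e_k]. *)
Definition alternating_eh q (k : nat) x : NL F :=
  \sum_(i < k.+1) eh_coef q i *: skew_h q (k - i)%N (skew_e q i%:Z x).

Lemma alternating_eh_is_linear q (k : nat) : linear (alternating_eh q k).
Proof.
apply: linear_sumf => i; apply: linear_Zf.
exact: linear_comp (skew_h_is_linear q _) (skew_e_is_linear q _).
Qed.

Lemma eh_coefS q i : eh_coef q i.+1 = - (eh_coef q i * q ^+ i).
Proof. by rewrite /eh_coef binS bin1 addnC exprS exprD; ring. Qed.

(** The shape of the cancellation in [alternating_eh_mul]: shifting [j] by one
    matches the second family with all of the first but its terms of index 0. *)
Lemma triangle_telescope (V : zmodType) (k : nat) (T : nat -> nat -> V) :
  \sum_(i < k.+1) \sum_(j < (k - i).+1) T i j
    - \sum_(i < k) \sum_(j < (k - i)%N) T i j.+1 = \sum_(i < k.+1) T i 0%N.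
Proof.
under eq_bigr => i _ do rewrite big_ord_recl.
rewrite big_split /= [X in _ + X - _]big_ord_recr /= subnn big_ord0 addr0.
exact: addrK.
Qed.

(** Taking one strand of [h_(a+1)] for [E_(i+1)] and [j] for [D] leaves the same
    strands as taking none for [E_i] and [j + 1] for [D]. The coefficients are
    opposite because [eh_coef (i+1) = - q^i eh_coef i] compensates the
    difference of the two powers of [q]. Only the terms in which [h_(a+1)] is
    untouched survive, and they all carry the factor [q^((a+1) k)]. *)
Lemma alternating_eh_mul q (k a : nat) y :
  alternating_eh q k (h F a%:Z * y) =
  q ^+ (a * k) *: (h F a%:Z * alternating_eh q k y).
Proof.
case: a => [|a]; first by rewrite mul0n scale1r !mul1r.
pose z i j := h F (a.+1%:Z - j%:Z) * skew_h q (k - i - j)%N (skew_e q i%:Z y).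
pose c i j := eh_coef q i * q ^+ (a.+1 * i) * q ^+ ((a.+1 - j) * (k - i - j)).
(* Both terms of the Leibniz rule of [skew_e] in the common terms
   [c i j *: z i j]; the second one involves those of index [i - 1]. *)
have skew_i i :
    eh_coef q i *: skew_h q (k - i)%N (skew_e q i%:Z (h F a.+1%:Z * y)) =
    (\sum_(j < (k - i).+1) c i j *: z i j) -
    (if i is i'.+1 then \sum_(j < (k - i).+1) c i' j.+1 *: z i' j.+1 else 0).
  rewrite skew_e_mul (linear_scale2 _ _ _ _ (skew_h_is_linear q _)).
  rewrite scalerDr; congr (_ + _).
    rewrite scalerA -PoszM -exprnP skew_h_mul scaler_sumr.
    by apply: eq_bigr => j _; rewrite scalerA.
  rewrite scalerA predz skew_h_mul scaler_sumr.
  case: i => [|i].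
    rewrite oppr0 big1 // => j _.
    rewrite sub0r -[- 1]/(Negz 0) skew_e_neg.
    by rewrite (linear_at0 (skew_h_is_linear q _)) mulr0 !scaler0.
  rewrite -sumrN; apply: eq_bigr => j _; rewrite scalerA -scaleNr predz.
  have -> : (k - i.+1 - j)%N = (k - i - j.+1)%N by rewrite -!subnDA addSn addnS.
  have -> : a%:Z - j%:Z = a.+1%:Z - j.+1%:Z.
    by rewrite intS [j.+1%:Z]intS opprD addrACA subrr add0r.
  have -> // : eh_coef q i.+1 * q ^ (a%:Z * i%:Z) *
      q ^+ ((a - j) * (k - i - j.+1)) = - c i j.+1.
  rewrite -PoszM -exprnP eh_coefS /c subSS.
  by rewrite mulSn exprD; ring.
transitivity (\sum_(i < k.+1) \sum_(j < (k - i).+1) c i j *: z i j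
    - \sum_(i < k) \sum_(j < (k - i)%N) c i j.+1 *: z i j.+1).
  rewrite /alternating_eh (eq_bigr _ (fun (i : 'I_k.+1) _ => skew_i i)) sumrB.
  congr (_ - _).
  rewrite big_ord_recl add0r; apply: eq_bigr => i _.
  by rewrite lift0 /= subnSK.
rewrite (triangle_telescope k (fun i j => c i j *: z i j)).
rewrite (linear_sum_scale _ _ _ (linear_mull (h F a.+1%:Z))) scaler_sumr.
apply: eq_bigr => i _; rewrite scalerA /z subr0 subn0.
have -> // : c i 0%N = q ^+ (a.+1 * k) * eh_coef q i.
by rewrite /c !subn0 -mulrA -exprD -mulnDr subnKC 1?mulrC // -ltnS.
Qed.

Lemma alternating_eh_eq0 q (k : nat) x : (0 < k)%N -> alternating_eh q k x = 0.
Proof.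
case: k => // k _; apply: (@eq_linear_malg _ _ _ _ (fun=> 0)) => {x} [||u].
- exact: alternating_eh_is_linear.
- exact: linear_0f.
elim/word_ind: u => [|n u IH].
  rewrite /alternating_eh big_ord_recl big1 => [|i _].
    by rewrite skew_e1 skew_h1 scaler0 addr0.
  by rewrite skew_e1 (linear_at0 (skew_h_is_linear q _)) scaler0.
by rewrite word_consE alternating_eh_mul IH mulr0 scaler0.
Qed.

Lemma pairing0l q y : pairing q 0 y = 0.
Proof. exact: linear_at0 (pairing_is_linear_l q y). Qed.

Lemma pairing0r q x : pairing q x 0 = 0.
Proof. exact: linear_at0 (pairing_is_linear q x). Qed.

(** The defining relation of the [e_i], multiplied by [y] and paired with [x],
    and the vanishing of [alternating_eh] are two linear relations with the same
    coefficients. By induction their terms agree except for the last ones, which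
    therefore agree too, as the coefficient is nonzero. *)
Lemma pairing_mul_e q k x y : q != 0 ->
  pairing q x (e q k * y) = pairing q (skew_e q k x) y.
Proof.
move=> q0; case: k => n; last by rewrite skew_e_neg mul0r pairing0r pairing0l.
elim/ltn_ind: n x y => -[|n] IH x y; first by rewrite e0 mul1r skew_e0.
pose lhs i := pairing q x (e q i%:Z * h F (n.+1%:Z - i%:Z) * y).
pose rhs i := pairing q (skew_h q (n.+1 - i)%N (skew_e q i%:Z x)) y.
have lhs0 : \sum_(i < n.+2) eh_coef q i * lhs i = 0.
  have f_lin : linear (fun z => pairing q x (z * y) : F^o).
    exact: linear_comp (pairing_is_linear q x) (linear_mulr y).
  have := linear_sum_scale (index_iota 0 n.+2) (eh_coef q)
    (fun i => e q i%:Z * h F (n.+1%:Z - i%:Z)) f_lin.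
  by rewrite e_rel // mul0r pairing0r big_mkord => /esym.
have rhs0 : \sum_(i < n.+2) eh_coef q i * rhs i = 0.
  have := linear_sum_scale (index_iota 0 n.+2) (eh_coef q)
    (fun i => skew_h q (n.+1 - i)%N (skew_e q i%:Z x))
    (pairing_is_linear_l q y).
  rewrite !big_mkord -/(alternating_eh q n.+1 x) alternating_eh_eq0 //.
  by rewrite pairing0l.
have eq_lr : \sum_(i < n.+1) eh_coef q i * lhs i =
    \sum_(i < n.+1) eh_coef q i * rhs i.
  apply: eq_bigr => i _; rewrite /lhs -mulrA IH // subzn; last exact: ltnW.
  by rewrite pairing_mul_h.
have := etrans lhs0 (esym rhs0).
rewrite 2!(big_ord_recr n.+1) /= eq_lr => /addrI/mulfI.
rewrite /lhs /rhs subrr mulr1 subnn skew_h0; apply.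
by rewrite mulf_neq0 ?expf_neq0 ?oppr_eq0 ?oner_eq0.
Qed.

(** * Insertion as a contraction of the coproduct *)
Definition pair_e q k u : F := pairing q << u >> (e q k).

Lemma pair_eE q k u : q != 0 -> pair_e q k u = (skew_e q k << u >>)@_mone.
Proof.
by move=> q0; rewrite /pair_e -[e q k]mulr1 pairing_mul_e // pairingU parts1.
Qed.

Lemma pair_e1 q k : q != 0 -> pair_e q k mone = (k == 0)%:R.
Proof.
move=> q0; rewrite pair_eE // skew_e1; case: (k == 0); last by rewrite mcoeff0.
by rewrite mcoeff1 eqxx.
Qed.

(** By iteration, [e_k] pairs nontrivially with no word but [h_1^k]. *)
Lemma pair_e_cons q k n u : q != 0 ->
  pair_e q k (mmul (fmu n) u) = if n is 0 then pair_e q (k - 1) u else 0.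
Proof.
move=> q0; rewrite pair_eE // word_consE skew_e_mul.
rewrite mcoeffD [X in X + _]mcoeffZ [X in _ + X]mcoeffZ.
rewrite [X in _ * X + _]coef1_hmul mulr0 add0r.
rewrite predz; case: n => [|n]; last by rewrite coef1_hmul mulr0.
by rewrite mul0r mul1r mul1r pair_eE.
Qed.

Lemma wdeg_cons n u : wdeg (mmul (fmu n) u) = (n.+1 + wdeg u)%N.
Proof. by rewrite /wdeg parts_cons. Qed.

Lemma wdeg_hword n : wdeg (hword n) = n.
Proof.
case: n => [|n]; first by rewrite /wdeg parts1.
by rewrite -[hword _]mulm1 wdeg_cons /wdeg parts1 addn0.
Qed.

Lemma pair_e_deg q k u : q != 0 -> pair_e q k u != 0 -> (wdeg u)%:Z = k.
Proof.
move=> q0; elim/word_ind: u k => [|n u IH] k.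
  by rewrite pair_e1 // /wdeg parts1; case: (k =P 0) => [->|_] //; rewrite eqxx.
rewrite pair_e_cons // wdeg_cons; case: n => [|n]; last by rewrite eqxx.
by move=> /IH e; rewrite add1n intS e addrC subrK.
Qed.

Definition contract q k (t : NL2 F) : NL F :=
  extend (fun p : word * word => pair_e q k p.1 *: << p.2 >>) t.

Lemma contract_is_linear q k : linear (contract q k).
Proof. exact: extend_is_linear. Qed.

Lemma contractU q k u v : contract q k << (u, v) >> = pair_e q k u *: << v >>.
Proof. exact: extendU. Qed.

Lemma h_mul_scaleU (c : F) n u :
  h F n%:Z * (c *: << u >>) = c *: << mmul (hword n) u >>.
Proof. by rewrite malg_scalerAr h_hword mulU. Qed.

(** The exponents of the product of tensors are degrees of words, those of
    [skew_e] are indices; they agree as soon as the pairing is nonzero. *)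
Lemma pair_e_exp q k (d : nat) u : q != 0 ->
  q ^+ (d * wdeg u) * pair_e q k u = q ^ (d%:Z * k) * pair_e q k u.
Proof.
move=> q0; have [->|/(pair_e_deg q0) <-] := eqVneq (pair_e q k u) 0.
  by rewrite !mulr0.
by rewrite -PoszM -exprnP.
Qed.

Definition pair_tmul q (p r : word * word) : NL2 F :=
  q ^+ (wdeg p.2 * wdeg r.1) *: << (mmul p.1 r.1, mmul p.2 r.2) >>.

Lemma tmulE q s t :
  tmul q s t = extend (fun p => extend (pair_tmul q p) t) s.
Proof.
rewrite /tmul /extend; apply: eq_bigr => p _; rewrite scaler_sumr.
apply: eq_bigr => r _; rewrite malgU_scale.
have scaler3 (V : lmodType F) (a b c : F) (x : V) :
  (c * (a * b)) *: x = a *: (b *: (c *: x)) by rewrite !scalerA mulrC.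
exact: scaler3.
Qed.

Lemma tensU u v : tens (<< u >> : NL F) << v >> = << (u, v) >>.
Proof. by rewrite /tens !msuppU oner_eq0 !big_seq_fset1 !mcoeffUU mulr1. Qed.

(** The terms [h_j (x) h_(n+1-j)] of the coproduct of [h_(n+1)] with [j > 1] are
    annihilated by [e_k], and those with [j = 0, 1] give the two terms of the
    Leibniz rule of [skew_e]. *)
Lemma contract_tmul q k n t : q != 0 ->
  contract q k (tmul q (Delta_gen F n.+1) t) =
    q ^ (n.+1%:Z * k) *: (h F n.+1%:Z * contract q k t) +
    q ^ (n%:Z * (k - 1)) *: (h F n%:Z * contract q (k - 1) t).
Proof.
move=> q0.
pose f t := contract q k (tmul q (Delta_gen F n.+1) t).
pose g t := q ^ (n.+1%:Z * k) *: (h F n.+1%:Z * contract q k t) +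
    q ^ (n%:Z * (k - 1)) *: (h F n%:Z * contract q (k - 1) t).
move: t; apply: (@eq_linear_malg _ _ _ f g) => [||[v w]].
- apply: linear_comp (contract_is_linear q k) _ => c s t.
  rewrite !tmulE /extend scaler_sumr -big_split; apply: eq_bigr => p _ /=.
  rewrite -![\sum_(u <- msupp _) _]/(extend (pair_tmul q p) _).
  by rewrite extend_is_linear scalerDr !scalerA [c * _]mulrC.
- by apply: linear_Df; apply: linear_Zf; apply: linear_comp (linear_mull _) _;
    apply: contract_is_linear.
pose T j := contract q k (pair_tmul q (hword j, hword (n.+1 - j)) (v, w)).
have fE : f << (v, w) >> = \sum_(j < n.+2) T j.
  rewrite /f tmulE /Delta_gen.
  pose F' s := contract q k
    (extend (fun p => extend (pair_tmul q p) << (v, w) >>) s).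
  have F'_lin : linear F'.
    exact: linear_comp (contract_is_linear q k) (extend_is_linear _).
  rewrite -/(F' _) (linear_app_sum _ _ F'_lin); apply: eq_bigr => j _.
  by rewrite 2!h_hword tensU /F' 2!extendU.
have TE j : T j =
    (q ^+ ((n.+1 - j) * wdeg v) * pair_e q k (mmul (hword j) v)) *:
    << mmul (hword (n.+1 - j)) w >>.
  rewrite /T /pair_tmul /= wdeg_hword.
  rewrite (linear_scale _ _ (contract_is_linear q k)).
  by rewrite contractU scalerA.
have T0 : T 0%N =
    q ^ (n.+1%:Z * k) *: (h F n.+1%:Z * contract q k << (v, w) >>).
  rewrite TE contractU h_mul_scaleU [RHS]scalerA.
  by rewrite -(pair_e_exp k n.+1 v q0) mul1m.
have T1 : T 1%N =
    q ^ (n%:Z * (k - 1)) *: (h F n%:Z * contract q (k - 1) << (v, w) >>).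
  have e1 : pair_e q k (mmul (hword 1) v) = pair_e q (k - 1) v.
    exact: pair_e_cons k 0 v q0.
  have n1 : (n.+1 - 1)%N = n by rewrite subn1.
  rewrite TE e1 n1 contractU h_mul_scaleU [RHS]scalerA.
  rewrite (pair_e_exp (k - 1) n v q0); reflexivity.
have Tbig j : T j.+2 = 0.
  have ej : pair_e q k (mmul (hword j.+2) v) = 0 := pair_e_cons k j.+1 v q0.
  by rewrite TE ej mulr0 scale0r.
move: fE T0 T1 Tbig; clearbody T => fE T0 T1 Tbig.
rewrite fE !big_ord_recl big1 => [|j _]; last exact: Tbig.
rewrite addr0; exact: (congr2 +%R T0 T1).
Qed.

Lemma contract_Delta q k x : q != 0 -> contract q k (Delta q x) = skew_e q k x.
Proof.
move=> q0; pose f x := contract q k (Delta q x).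
move: x; apply: (@eq_linear_malg _ _ _ f) => [||u].
- exact: linear_comp (contract_is_linear q k) (extend_is_linear _).
- exact: skew_e_is_linear.
rewrite /f [Delta _ _]extendU; elim/word_ind: u k {f} => [|n u IH] k.
  rewrite parts1 /= tensU contractU skew_e1 pair_e1 //.
  by case: (k == 0); rewrite ?scale1r ?scale0r.
rewrite parts_cons /= contract_tmul // !IH word_consE.
rewrite skew_e_mul.
by rewrite predz.
Qed.

Lemma insertionE q (mu lambda : seq int) k x : q != 0 ->
  insertion q mu lambda k x =
  pairing q (hs F mu * skew_e q k (hs F lambda)) x.
Proof.
move=> q0; rewrite /insertion -contract_Delta //; move: (Delta _ _) => D.
pose g y : F^o := pairing q (hs F mu * y) x.
have g_lin : linear g.
  exact: linear_comp (pairing_is_linear_l q x) (linear_mull _).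
transitivity (\sum_(p <- msupp D) D@_p *: g (pair_e q k p.1 *: << p.2 >>)).
  apply: eq_bigr => p _; rewrite (linear_scale _ _ g_lin).
  by rewrite -[LHS]mulrA.
exact/esym/(linear_sum_scale _ _ _ g_lin).
Qed.

End SkewE.

(** * Expanding the first [m] factors *)
Lemma big_tuple_cons (V : nmodType) (T : finType) m (G : seq T -> V) :
  \sum_(s : m.+1.-tuple T) G s = \sum_(b : T) \sum_(s : m.-tuple T) G (b :: s).
Proof.
rewrite pair_big /=.
rewrite (reindex (fun p : T * m.-tuple T => [tuple of p.1 :: p.2])) //=.
exists (fun s => (thead s, [tuple of behead s])) => [[b s] _|s _] /=.
  by congr (_, _); apply: val_inj.
by rewrite [RHS]tuple_eta.
Qed.

Lemma sum_bin_seqs (V : zmodType) m (G : nat -> seq bool -> V) :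
  \sum_(0 <= l < m.+1) \sum_(s in bin_seqs m l) G l s =
  \sum_(s : m.-tuple bool) G (count_mem true s) s.
Proof.
pose ones (s : m.-tuple bool) : 'I_m.+1 := inord (count_mem true s).
rewrite big_mkord (partition_big ones predT) //=.
apply: eq_bigr => l _; apply: eq_big => s; last by rewrite inE => /eqP->.
rewrite inE -val_eqE /ones /= inordK // ltnS -{2}(size_tuple s).
exact: count_size.
Qed.

(** The partial sums start at an offset [c], the number of ones that come before
    the sequence, to make the exponent recursive in the sequence. *)
Definition strand_exp (lam : seq int) (k c : int) (s : seq bool) : int :=
  seq_sum (muls (subs lam (seq_of_bits s))
                (subs (nseq (size lam) k) (scanl +%R c (seq_of_bits s)))).

Lemma strand_exp_cons a lam k c b (s : seq bool) :
  strand_exp (a :: lam) k c (b :: s) =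
  (a - b%:Z) * (k - (c + b%:Z)) + strand_exp lam k (c + b%:Z) s.
Proof. by rewrite /strand_exp /seq_sum /= big_cons. Qed.

Lemma skew_e_expand (F : fieldType) (q : F) m (k c : int) (alpha : seq nat) :
  q != 0 -> (m <= size alpha)%N ->
  skew_e q (k - c) (hseq F alpha) =
  \sum_(s : m.-tuple bool)
    q ^ strand_exp [seq a%:Z | a <- take m alpha] k c s *:
      (hs F (subs [seq a%:Z | a <- take m alpha] (seq_of_bits s)) *
       skew_e q (k - c - (count_mem true s)%:Z) (hseq F (drop m alpha))).
Proof.
move=> q0; elim: m c alpha => [|m IH] c alpha le_m.
  rewrite (big_pred1 [tuple]) => [|s]; last by apply/esym/eqP; exact: tuple0.
  rewrite take0 drop0 /strand_exp /seq_sum /= big_nil expr0z scale1r.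
  by rewrite /hs big_nil mul1r subr0.
case: alpha le_m => // a alpha le_m.
pose lam := [seq a%:Z | a <- take m alpha].
pose tail := hseq F (drop m alpha).
pose G (s : seq bool) := q ^ strand_exp (a%:Z :: lam) k c s *:
  (hs F (subs (a%:Z :: lam) (seq_of_bits s)) *
   skew_e q (k - c - (count_mem true s)%:Z) tail).
rewrite -[RHS]/(\sum_(s : m.+1.-tuple bool) G s) big_tuple_cons.
have step (b : bool) : \sum_(s : m.-tuple bool) G (b :: s) =
    q ^ ((a%:Z - b%:Z) * (k - c - b%:Z)) *:
      (h F (a%:Z - b%:Z) * skew_e q (k - c - b%:Z) (hseq F alpha)).
  have -> : k - c - b%:Z = k - (c + b%:Z) by rewrite opprD addrA.
  rewrite (IH (c + b%:Z) alpha le_m) (linear_sum_scale _ _ _ (linear_mull _)).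
  rewrite scaler_sumr; apply: eq_bigr => s _.
  have -> : G (b :: s) =
      q ^ ((a%:Z - b%:Z) * (k - (c + b%:Z)) +
           strand_exp lam k (c + b%:Z) s) *:
      (h F (a%:Z - b%:Z) * hs F (subs lam (seq_of_bits s)) *
       skew_e q (k - (c + b%:Z) - (count_mem true s)%:Z) tail).
    have <- : hs F (subs (a%:Z :: lam) (seq_of_bits (b :: s))) =
        h F (a%:Z - b%:Z) * hs F (subs lam (seq_of_bits s)).
      exact: big_cons.
    have <- : k - c - (count_mem true (b :: s))%:Z =
        k - (c + b%:Z) - (count_mem true s)%:Z.
      by rewrite /= eqb_id PoszD !opprD !addrA.
    by rewrite -strand_exp_cons.
  rewrite [X in X *: _ = _](expfzDr _ _ q0).
  have scaler_mulA (A : lalgType F) (u v : F) (x y z : A) :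
    (u * v) *: (x * y * z) = u *: (v *: (x * (y * z))) by rewrite scalerA mulrA.
  exact: scaler_mulA.
have step0 : \sum_(s : m.-tuple bool) G (false :: s) =
    q ^ ((a%:Z - 0) * (k - c - 0)) *:
      (h F (a%:Z - 0) * skew_e q (k - c - 0) (hseq F alpha)) := step false.
rewrite !subr0 in step0.
rewrite big_bool.
apply: etrans (congr2 +%R (esym (step true)) (esym step0)).
rewrite hseq_cons skew_e_mul.
exact: addrC.
Qed.

Theorem lemma6p6 (R : realType) (q : R[i]) (lambda : seq nat) (k : nat)
    (x : NL R[i]) (m : nat) :
  q != 0 -> (1 <= m <= size lambda)%N ->
  let lam := [seq a%:Z | a <- lambda] in
  let lamL := take m lam in
  let lamG := drop m lam in
  pairing q (hs R[i] lam) (e q k%:Z * x) =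
  \sum_(0 <= l < m.+1) \sum_(sigma in bin_seqs m l)
    let s := seq_of_bits sigma in
    q ^ seq_sum (muls (subs lamL s) (subs (nseq m k%:Z) (psums s)))
    * insertion q (subs lamL s) lamG (k%:Z - l%:Z) x.
Proof.
move=> q0 /andP[_ le_m] lam lamL lamG.
pose G l (s : seq bool) := let s := seq_of_bits s in
    q ^ seq_sum (muls (subs lamL s) (subs (nseq m k%:Z) (psums s)))
    * insertion q (subs lamL s) lamG (k%:Z - l%:Z) x.
rewrite (sum_bin_seqs m G) pairing_mul_e //.
rewrite hs_hseq -[k%:Z]subr0 (skew_e_expand k%:Z 0 q0 le_m) subr0.
rewrite (linear_sum_scale _ _ _ (pairing_is_linear_l q x)).
apply: eq_bigr => s _.
rewrite /G (insertionE _ _ _ _ q0) /lamG -map_drop (hs_hseq _ (drop m lambda)).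
by rewrite /lamL -map_take /strand_exp size_map size_takel.
Qed.
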